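(* Let $(\Omega,\Sigma,\mu)$ be an arbitrary measure space and set $X=L_1(\mu;\mathbb{R})$. Let $0<\delta\leq 2$, let $(C_i)_{i=1}^\infty$ be non-empty wHD-$\delta$ subsets of the closed unit ball $B_X$, and let $\lambda_i\geq 0$ with $\sum_{i=1}^\infty\lambda_i=1$. Then $\sum_{i=1}^\infty \lambda_i C_i$ is wHD-$(\delta/4)$.
   Context: For a non-empty bounded subset $C$ of a Banach space, $\operatorname{diam}(C)=\sup\{\|x-y\|:x,y\in C\}$. For a real Banach space $Y$ with closed unit ball $B_Y$ and $0<\delta\le 2$, a non-empty set $C\subset B_Y$ is called weakly hereditarily diameter $\delta$ (wHD-$\delta$) if $\operatorname{diam}(C\cap W)\ge\delta$ for every weakly open set $W\subset Y$ with $C\cap W\neq\emptyset$. For subsets $C_i\subset B_X$ and $\lambda_i\ge 0$ with $\sum_i\lambda_i=1$, $\sum_i\lambda_iC_i=\{\sum_i\lambda_ic_i : c_i\in C_i\}$, where the series are norm convergent (absolutely, since $C_i\subset B_X$). *)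

(* Defs.v *)
From HB Require Import structures.
From mathcomp Require Import all_boot all_order all_algebra.
From mathcomp Require Import all_classical all_reals all_analysis measurable_realfun ess_sup_inf.

Set Implicit Arguments.
Unset Strict Implicit.
Unset Printing Implicit Defensive.

Import Order.TTheory GRing.Theory Num.Theory.
Import numFieldNormedType.Exports.

Local Open Scope classical_set_scope.
Local Open Scope ring_scope.

(** The library defines [LspaceType mu p1], the type of a.e.-equality classes of
    measurable functions with finite p-norm, without any algebraic structure.
    We equip it with its usual normed space structure, transported from the
    space [LfunType mu p1] of functions. *)
Section Lspace_normed.
Context d (T : measurableType d) (R : realType).
Variables (mu : {measure set T -> \bar R}) (p : \bar R) (p1 : (1 <= p)%E).

Local Notation Lf := (LfunType mu p1).
Local Notation Ls := (LspaceType mu p1).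
Local Notation mfunR := {mfun T >-> measurableTypeR R}.
Local Notation mfunQ := {mfun_ mu, T >-> measurableTypeR R}.
Local Open Scope quotient_scope.

Lemma ae_eq_Lnorm (f g : T -> R) :
  measurable_fun setT f -> measurable_fun setT g ->
  f = g %[ae mu] -> ('N[mu]_p[EFin \o f] = 'N[mu]_p[EFin \o g])%E.
Proof.
move=> mf mg fg; rewrite unlock /Lnorm.
have pfg : (\forall x \ae mu, `|(f x)%:E| = `|(g x)%:E|)%E.
  by apply: filterS fg => x /(_ I) ->.
have mpow (h : T -> R) r : measurable_fun setT h ->
    measurable_fun setT (fun x => `|(h x)%:E| `^ r)%E.
  move=> mh; apply: (@measurableT_comp _ _ _ _ _ _ (fun x => x `^ r)%E) => //.
    exact: measurable_poweR.
  by apply: measurableT_comp => //; exact/measurable_EFinP.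
case: p => [r||].
- congr (_ `^ _)%E; apply: ae_eq_integral => //; [exact: mpow..|].
  by apply: filterS pfg => x E _; exact: (congr1 (fun y => y `^ r)%E E).
- by case: ifPn => // _; exact: eq_ess_sup.
- by case: ifPn => // _; exact: eq_ess_inf.
Qed.

Let Lspace_inj (f g : Ls) : (f : mfunQ) = (g : mfunQ) -> f = g.
Proof.
case: f => [f [[hf]]]; case: g => [g [[hg]]] /= fg.
by subst g; rewrite (Prop_irrelevance hf hg).
Qed.

Let class_of (f : mfunR) : mfunQ := \pi_(mfunQ) f.

Let class_ofE (f : mfunR) : (class_of f : T -> R) = f %[ae mu].
Proof.
suff: repr (class_of f) == f %[mod mfunQ] by rewrite eqmodE => /asboolP.
by rewrite reprK.
Qed.

(* The library uses two measurable structures on the reals, with the same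
   measurable sets: [R] itself, and [measurableTypeR R] in [LspaceType]. *)
Let mfunR_subproof (f : Lf) : (f : T -> measurableTypeR R) \in mfun.
Proof. by rewrite inE; exact: (@measurable_funPT _ _ _ _ f). Qed.

Let mfunR_of (f : Lf) : mfunR := mfun_Sub (mfunR_subproof f).

Let pi_finite (f : Lf) : finite_norm mu p (class_of (mfunR_of f)).
Proof.
rewrite /finite_norm (@ae_eq_Lnorm _ f) //; first exact: Lfunction_finite.
exact: (@measurable_funPT _ _ _ _ (repr (class_of (mfunR_of f)))).
Qed.

Definition Lspace_of (f : Lf) : Ls :=
  HB.pack (class_of (mfunR_of f))
    (isFinLebesgue.Build d T R mu p p1 (class_of (mfunR_of f)) (pi_finite f)).

Let Lfun_of_subproof (f : Ls) : (f : T -> R) \in Lfun mu p.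
Proof.
apply/andP; split; last by rewrite inE/=; case: f => f [[]].
by rewrite inE/=; exact: (@measurable_funPT _ _ _ _ (repr (f : mfunQ))).
Qed.

Definition Lfun_of (f : Ls) : Lf := Lfun_Sub p1 (Lfun_of_subproof f).

Lemma Lspace_of_eq (f g : Lf) :
  Lspace_of f = Lspace_of g <-> (f : T -> R) = g %[ae mu].
Proof.
split=> [fg|fg]; last first.
  by apply: Lspace_inj => /=; apply/eqP; rewrite eqmodE; exact/asboolP.
have /eqP := congr1 (fun h : Ls => h : mfunQ) fg.
by rewrite /= eqmodE => /asboolP.
Qed.

Lemma Lspace_ofK (f : Lf) : (Lfun_of (Lspace_of f) : T -> R) = f %[ae mu].
Proof. exact: class_ofE. Qed.

Lemma Lfun_ofK : cancel Lfun_of Lspace_of.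
Proof.
move=> f; apply: Lspace_inj; rewrite /= -[RHS]reprK; congr (\pi_(mfunQ) _).
exact: val_inj.
Qed.

HB.instance Definition _ := gen_eqMixin Ls.
HB.instance Definition _ := gen_choiceMixin Ls.

Definition Lspace_add (f g : Ls) : Ls := Lspace_of (Lfun_of f + Lfun_of g).
Definition Lspace_opp (f : Ls) : Ls := Lspace_of (- Lfun_of f).
Definition Lspace_scale (a : R) (f : Ls) : Ls := Lspace_of (a *: Lfun_of f).
Definition Lspace_norm (f : Ls) : R := fine ('N[mu]_p[EFin \o Lfun_of f])%E.

Lemma Lspace_ofD (f g : Lf) :
  Lspace_add (Lspace_of f) (Lspace_of g) = Lspace_of (f + g).
Proof.
apply/Lspace_of_eq; apply: filterS2 (Lspace_ofK f) (Lspace_ofK g).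
by move=> x /(_ I) fx /(_ I) gx _; congr (_ + _).
Qed.

Lemma Lspace_ofN (f : Lf) : Lspace_opp (Lspace_of f) = Lspace_of (- f).
Proof.
apply/Lspace_of_eq; apply: filterS (Lspace_ofK f).
by move=> x /(_ I) fx _; congr (- _).
Qed.

Lemma Lspace_ofZ (a : R) (f : Lf) :
  Lspace_scale a (Lspace_of f) = Lspace_of (a *: f).
Proof.
apply/Lspace_of_eq; apply: filterS (Lspace_ofK f).
by move=> x /(_ I) fx _; congr (_ *: _).
Qed.

Lemma Lspace_of_norm (f : Lf) :
  Lspace_norm (Lspace_of f) = fine ('N[mu]_p[EFin \o f])%E.
Proof.
congr fine; apply: ae_eq_Lnorm; [exact: measurable_funPT..|].
exact: Lspace_ofK.
Qed.

Let Lspace_ind (P : Ls -> Prop) : (forall f, P (Lspace_of f)) -> forall f, P f.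
Proof. by move=> H f; rewrite -(Lfun_ofK f). Qed.

Let addA : associative Lspace_add.
Proof.
elim/Lspace_ind => f; elim/Lspace_ind => g; elim/Lspace_ind => h.
by rewrite !Lspace_ofD addrA.
Qed.

Let addC : commutative Lspace_add.
Proof. by move=> f g; rewrite /Lspace_add addrC. Qed.

Let add0 : left_id (Lspace_of 0) Lspace_add.
Proof. by elim/Lspace_ind => f; rewrite Lspace_ofD add0r. Qed.

Let addN : left_inverse (Lspace_of 0) Lspace_opp Lspace_add.
Proof. by elim/Lspace_ind => f; rewrite Lspace_ofN Lspace_ofD addNr. Qed.

HB.instance Definition _ := GRing.isZmodule.Build Ls addA addC add0 addN.

Let of_add (f g : Lf) : Lspace_of f + Lspace_of g = Lspace_of (f + g).
Proof. exact: Lspace_ofD. Qed.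

Let scaleA (a b : R) (f : Ls) :
  Lspace_scale a (Lspace_scale b f) = Lspace_scale (a * b) f.
Proof. by elim/Lspace_ind: f => f; rewrite !Lspace_ofZ scalerA. Qed.

Let scale1 : left_id 1 Lspace_scale.
Proof. by elim/Lspace_ind => f; rewrite Lspace_ofZ scale1r. Qed.

Let scaleDr : right_distributive Lspace_scale +%R.
Proof.
move=> a; elim/Lspace_ind => f; elim/Lspace_ind => g.
by rewrite of_add !Lspace_ofZ of_add scalerDr.
Qed.

Let scaleDl (f : Ls) : {morph Lspace_scale^~ f : a b / a + b}.
Proof.
elim/Lspace_ind: f => f a b.
by rewrite !Lspace_ofZ of_add scalerDl.
Qed.

HB.instance Definition _ :=
  GRing.Zmodule_isLmodule.Build R Ls scaleA scale1 scaleDr scaleDl.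

Let ler_normD (f g : Ls) : Lspace_norm (f + g) <= Lspace_norm f + Lspace_norm g.
Proof.
elim/Lspace_ind: f => f; elim/Lspace_ind: g => g.
by rewrite of_add !Lspace_of_norm ler_LnormD.
Qed.

Let normrZ (a : R) (f : Ls) : Lspace_norm (a *: f) = `|a| * Lspace_norm f.
Proof.
elim/Lspace_ind: f => f; rewrite [_ *: _]Lspace_ofZ !Lspace_of_norm.
by rewrite LnormZ fineM// -finite_norm_fine.
Qed.

Let normr0_eq0 (f : Ls) : Lspace_norm f = 0 -> f = 0.
Proof.
elim/Lspace_ind: f => f; rewrite Lspace_of_norm => /fine_Lnormr_eq0 f0.
exact/Lspace_of_eq.
Qed.

HB.instance Definition _ :=
  Lmodule_isNormed.Build R Ls ler_normD normrZ normr0_eq0.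

End Lspace_normed.

Lemma Lspace1_normE d (T : measurableType d) (R : realType)
    (mu : {measure set T -> \bar R}) (f : LspaceType1 mu) :
  (`|f|%:E = \int[mu]_x `|(f x)%:E|)%E.
Proof. by rewrite -[in RHS]Lnorm1 -(finite_norm_fine (Lfun_of f)). Qed.

Section wHD.
Context (R : realType) (V : normedModType R).

(** [V] with the weak topology: the coarsest topology that makes every
    norm-continuous linear functional continuous. *)
Definition weak_space : topologicalType :=
  sup_topology (fun f : {f : {linear V -> R^o} | continuous f} =>
    Topological.on (initial_topology (sval f))).

Definition weakly_open (W : set V) := open (W : set weak_space).

(* meaningful for non-empty bounded sets, otherwise [sup] is a junk value *)
Definition diam (C : set V) : R := sup [set `|x - y| | x in C & y in C].

Definition wHD (delta : R) (C : set V) :=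
  [/\ C !=set0, C `<=` [set x | `|x| <= 1] &
      forall W, weakly_open W -> C `&` W !=set0 -> delta <= diam (C `&` W)].

(** The set of all sums of norm convergent series [\sum_i lambda i *: c i] with
    [c i \in C i]. *)
Definition series_combination (lambda : R^nat) (C : nat -> set V) : set V :=
  [set x | exists2 c : nat -> V, (forall i, C i (c i)) &
    series (fun i => lambda i *: c i) @ \oo --> x].

End wHD.

(* Main.v *)
Require Import Defs.
From HB Require Import structures.
From mathcomp Require Import all_boot all_order all_algebra.
From mathcomp Require Import all_classical all_reals all_analysis measurable_realfun.
From mathcomp Require Import ring lra.

Set Implicit Arguments.
Unset Strict Implicit.
Unset Printing Implicit Defensive.

Import Order.TTheory GRing.Theory Num.Theory.
Import numFieldNormedType.Exports.

Local Open Scope classical_set_scope.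
Local Open Scope ring_scope.

(** The proof rests on a perturbation property of L_1: if [C] is wHD-delta,
    [2 rho < delta] and the weakly open set [W] meets [C], then for every [f]
    there are [y], [z] in [C `&` W] with [|f + (y - z)| >= |f| + rho].
    The convex functional [Phi g = \int sqrt (f ^ 2 + g ^ 2)] is bounded on [C];
    choose [z] in [C `&` W] almost maximizing it. The linearization of [Phi] at
    [z] is the pairing with the bounded function [h = z / sqrt (f ^ 2 + z ^ 2)],
    so for [y] in a smaller weak neighbourhood of [z] the nonnegative function
    [sqrt (f ^ 2 + y ^ 2) - sqrt (f ^ 2 + z ^ 2) - h (y - z)] has a small
    integral. By strict convexity [y - z] is then almost disjoint from [f], so
    the norms of [f] and [y - z] almost add up.
    Given a point of the series set in a weakly open set, applying this to its
    first [n] coordinates one after the other, with [f] the difference built so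
    far, yields two points of the set that are far apart. *)

(** * Pointwise estimates for the convex function [sqrt (a ^ 2 + y ^ 2)] of [y] *)

Definition hypot_gap (R : realType) (a y z : R) : R :=
  Num.sqrt (a ^+ 2 + y ^+ 2) - Num.sqrt (a ^+ 2 + z ^+ 2)
  - z / Num.sqrt (a ^+ 2 + z ^+ 2) * (y - z).

Section hypot.
Context (R : realType).
Implicit Types a y z M eta : R.

Lemma hypot_le a y : Num.sqrt (a ^+ 2 + y ^+ 2) <= `|a| + `|y|.
Proof.
rewrite -(@ger0_norm _ (`|a| + `|y|)) ?addr_ge0// -sqrtr_sqr ler_wsqrtr//.
rewrite sqrrD !real_normK ?num_real//.
have := mulr_ge0 (normr_ge0 a) (normr_ge0 y); lra.
Qed.

Lemma hypot_ge a y : `|y| <= Num.sqrt (a ^+ 2 + y ^+ 2).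
Proof. by rewrite -sqrtr_sqr ler_wsqrtr// lerDr sqr_ge0. Qed.

Lemma norm_div_hypot_le1 a z : `|z / Num.sqrt (a ^+ 2 + z ^+ 2)| <= 1.
Proof.
rewrite normrM normfV (@ger0_norm _ (Num.sqrt _)) ?sqrtr_ge0//.
have := sqrtr_ge0 (a ^+ 2 + z ^+ 2); rewrite le_eqVlt => /predU1P[<-|p0].
  by rewrite invr0 mulr0.
by rewrite ler_pdivrMr// mul1r hypot_ge.
Qed.

(* With p = (a, z) and q = (a, y), the gap is |q| - <p, q> / |p|, and
   (|p||q| - <p, q>)(|p||q| + <p, q>) = a ^ 2 (y - z) ^ 2. *)
Lemma mul_hypot_gap a y z :
  let p := Num.sqrt (a ^+ 2 + z ^+ 2) in let q := Num.sqrt (a ^+ 2 + y ^+ 2) in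
  0 <= hypot_gap a y z /\
  a ^+ 2 * (y - z) ^+ 2 <= 2 * p ^+ 2 * q * hypot_gap a y z.
Proof.
move=> p q; rewrite /hypot_gap -/p -/q.
have p2 : p ^+ 2 = a ^+ 2 + z ^+ 2 by rewrite sqr_sqrtr// addr_ge0// sqr_ge0.
have q2 : q ^+ 2 = a ^+ 2 + y ^+ 2 by rewrite sqr_sqrtr// addr_ge0// sqr_ge0.
have p0 : 0 <= p by exact: sqrtr_ge0.
have q0 : 0 <= q by exact: sqrtr_ge0.
(* If [p = 0], then [a = z = 0]; as [0^-1 = 0], the gap is [q], and both sides of the second claim
   vanish. *)
move: p0; rewrite le_eqVlt => /predU1P[p0|p0].
  rewrite -p0 invr0 mulr0 mul0r !subr0 expr0n/= mulr0 !mul0r; split => //.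
  have : a ^+ 2 = 0 by have := sqr_ge0 a; have := sqr_ge0 z; rewrite -p0 in p2; nra.
  by move=> ->; rewrite mul0r.
set s := a ^+ 2 + z * y.
have D : q - p - z / p * (y - z) = (p * q - s) / p.
  rewrite /s; apply: (mulIf (lt0r_neq0 p0)); rewrite divfK ?lt0r_neq0//.
  rewrite !mulrBl; have -> : z / p * (y - z) * p = z * (y - z) by field; lra.
  nra.
have id : (p * q - s) * (p * q + s) = a ^+ 2 * (y - z) ^+ 2.
  have -> : (p * q - s) * (p * q + s) = p ^+ 2 * q ^+ 2 - s ^+ 2 by ring.
  by rewrite p2 q2 /s; ring.
(* Cauchy-Schwarz, read off from [id], whose right-hand side is nonnegative. *)
have sle : `|s| <= p * q.
  have pq0 : 0 <= p * q by rewrite mulr_ge0// ltW.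
  rewrite -(ger0_norm pq0) -(@ler_pXn2r _ 2) ?nnegrE//.
  rewrite !real_normK ?num_real//; have := mulr_ge0 (sqr_ge0 a) (sqr_ge0 (y - z)).
  by rewrite -id; nra.
move: sle; rewrite ler_norml => /andP[s1 s2].
rewrite D; split; first by rewrite divr_ge0 ?subr_ge0// ltW.
have -> : 2 * p ^+ 2 * q * ((p * q - s) / p) = (p * q - s) * (2 * (p * q)).
  by field; lra.
by rewrite -id; apply: ler_wpM2l; lra.
Qed.

(** With [t = y - z], the loss [|a| + |t| - |a + t|] is at most twice the minimum of [|a|] and
    [|t|], and each of the three error terms controls this minimum in one regime: [|z|] large
    compared with [|a|], then [|t| <= |a|], then [|t| > |a|]. The parameter [M] cuts off the first
    regime, where the gap is too flat to be of use. *)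
Lemma norm_addB_ge a y z M eta : 1 <= M -> 0 < eta -> eta <= 1 ->
  `|a| + `|y - z| <= `|a + (y - z)| +
    2 * (M^-1 * `|z| + eta * `|a| + 12 * M ^+ 3 / eta * hypot_gap a y z).
Proof.
move=> M1 eta0 eta1; have [D0] := mul_hypot_gap a y z.
set D := hypot_gap a y z in D0 *; set p := Num.sqrt _; set q := Num.sqrt _ => Dge.
set t := y - z in Dge *; set K := 12 * M ^+ 3 / eta.
have M3 : 1 <= M ^+ 3 by rewrite exprn_ege1.
have K12 : 12 * M ^+ 3 <= K by rewrite /K ler_pdivlMr//; nra.
have KD : 0 <= K * D by rewrite mulr_ge0//; lra.
have t0 : 0 <= `|t| by []. have a0 : 0 <= `|a| by []. have z0 : 0 <= `|z| by [].
have Mz : 0 <= M^-1 * `|z| by rewrite mulr_ge0 ?invr_ge0//; lra.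
have ea : 0 <= eta * `|a| by rewrite mulr_ge0// ltW.
have tri1 : `|a| - `|t| <= `|a + t| by have := ler_normB (a + t) t; rewrite addrK; lra.
have tri2 : `|t| - `|a| <= `|a + t|.
  by have := ler_normB (a + t) a; rewrite addrAC subrr add0r; lra.
have [Maz|zMa] := leP (M * `|a|) `|z|.
  have : `|a| <= M^-1 * `|z| by rewrite mulrC ler_pdivlMr ?(mulrC `|a|)//; lra.
  lra.
have ap : 0 < `|a|.
  by rewrite lt_neqAle a0 andbT; apply/eqP => e; rewrite -e in zMa; lra.
have p2 : p ^+ 2 <= 2 * M ^+ 2 * `|a| ^+ 2.
  rewrite sqr_sqrtr ?addr_ge0 ?sqr_ge0//.
  rewrite -(real_normK (num_real a)) -(real_normK (num_real z)).
  have : `|z| ^+ 2 <= (M * `|a|) ^+ 2 by rewrite (@ler_pXn2r _ 2) ?nnegrE//; nra.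
  have : `|a| ^+ 2 <= (M * `|a|) ^+ 2 by rewrite (@ler_pXn2r _ 2) ?nnegrE//; nra.
  rewrite exprMn; lra.
have qle : q <= 2 * (M * `|a|) + `|t|.
  apply: (le_trans (hypot_le a y)).
  have : `|y| <= `|z| + `|t| by rewrite /t -[X in `|X| <= _](subrK z) addrC ler_normD.
  nra.
(* This is [mul_hypot_gap] divided by [a ^ 2], with [p2] and [qle] inserted. *)
have key : `|t| ^+ 2 <= 4 * M ^+ 2 * (2 * (M * `|a|) + `|t|) * D.
  have H : `|a| ^+ 2 * `|t| ^+ 2 <=
      `|a| ^+ 2 * (4 * M ^+ 2 * (2 * (M * `|a|) + `|t|) * D).
    rewrite !real_normK ?num_real//; apply: (le_trans Dge).
    rewrite -(real_normK (num_real a)).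
    have -> : `|a| ^+ 2 * (4 * M ^+ 2 * (2 * (M * `|a|) + `|t|) * D) =
      2 * ((2 * M ^+ 2 * `|a| ^+ 2) * ((2 * (M * `|a|) + `|t|) * D)) by ring.
    rewrite -2!mulrA ler_pM2l//; apply: ler_pM => //.
    - by rewrite sqr_ge0.
    - by rewrite mulr_ge0// sqrtr_ge0.
    - by rewrite ler_wpM2r.
  by move: H; rewrite ler_pM2l// exprn_gt0.
have M2 : 0 <= M ^+ 2 by rewrite sqr_ge0.
have [ta|at_] := leP `|t| `|a|.
  (* AM-GM on [|t| = sqrt (eta |a|) * (|t| / sqrt (eta |a|))] *)
  suff : `|t| <= eta * `|a| + K * D by lra.
  have H : `|t| ^+ 2 <= K * D * (eta * `|a|).
    apply: (le_trans key); rewrite /K.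
    have -> : 12 * M ^+ 3 / eta * D * (eta * `|a|) =
              4 * M ^+ 2 * (3 * (M * `|a|)) * D by field; lra.
    rewrite ler_wpM2r// ler_wpM2l// ?mulr_ge0//; nra.
  rewrite -(@ler_pXn2r _ 2) ?nnegrE ?addr_ge0//; apply: (le_trans H).
  nra.
(* Now [2 M |a| + |t| <= 3 M |t|], so dividing [key] by [|t|] bounds [|t|] linearly in the gap, with
   constant [12 = 4 * 3]. *)
suff : `|a| <= K * D by lra.
apply: (@le_trans _ _ (12 * M ^+ 3 * D)); last by rewrite ler_wpM2r.
apply: (le_trans (ltW at_)).
have tp : 0 < `|t| by lra.
rewrite -(ler_pM2l tp) -expr2; apply: (le_trans key).
have -> : `|t| * (12 * M ^+ 3 * D) = 4 * M ^+ 2 * (3 * (M * `|t|)) * D by ring.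
rewrite ler_wpM2r// ler_wpM2l// ?mulr_ge0//; nra.
Qed.

End hypot.

(** * Weak topology, diameters and series combinations in a normed space *)

Section normed_space.
Context (R : realType) (V : normedModType R).
Implicit Types (x v c : V) (W : set V).

Lemma weakly_openI W1 W2 : weakly_open W1 -> weakly_open W2 ->
  weakly_open (W1 `&` W2).
Proof. exact: (@openI (weak_space V)). Qed.

(** The weak topology is a supremum of initial topologies, so continuity of a map into it is tested
    on functionals. *)
Lemma weakly_open_preimage (Y : topologicalType) (g : Y -> V) :
  (forall f : {linear V -> R^o}, continuous f -> continuous (f \o g)) ->
  forall W, weakly_open W -> open (g @^-1` W).
Proof.
move=> fg; suff : continuous (g : Y -> weak_space V) by move/continuousP.
move=> y; apply/cvg_sup => -[f cf].
exact: (@continuous_comp_initial _ _ _ (f : V -> R^o) g (fg f cf)).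
Qed.

Lemma weak_functional_continuous (f : {linear V -> R^o}) :
  continuous f -> continuous (f : weak_space V -> R^o).
Proof.
move=> cf x.
have := @cvg_sup _ _ (fun f : {f : {linear V -> R^o} | continuous f} =>
    Topological.on (initial_topology (sval f))) (nbhs (x : weak_space V)) x _.
move=> [+ _] => /(_ (fun A h => h)) /(_ (exist _ f cf)) H.
apply: (cvg_comp _ _ H); exact: (@initial_continuous V R^o f).
Qed.

(** Turns a weak constraint on a sum into a weak constraint on one of its summands. *)
Lemma weakly_open_affine W v (a : R) : weakly_open W ->
  weakly_open [set y | W (v + a *: y)].
Proof.
apply: (@weakly_open_preimage (weak_space V) (fun y => v + a *: y)) => f cf.
have -> : f \o (fun y => v + a *: y) = (fun y => f v + a *: f y).
  by apply/funext => y /=; rewrite linearD linearZ.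
have G (Y : topologicalType) (g : Y -> R^o) : continuous g ->
    continuous (fun y => f v + a *: g y).
  move=> cg y; apply: cvgD; first exact: cvg_cst.
  by apply: cvgZl_tmp; exact: cg.
exact: G (weak_functional_continuous cf).
Qed.

Lemma weakly_open_strip (f : {linear V -> R^o}) x (e : R) : continuous f ->
  weakly_open [set y | `|f y - f x| < e].
Proof.
move=> cf; rewrite (_ : mkset _ = f @^-1` ball (f x : R^o) e); last first.
  by apply/seteqP; split => y /=; rewrite /ball/= distrC.
have /continuousP := weak_functional_continuous cf.
move=> /(_ _ (@ball_open _ R^o (f x) e)) H; exact: H.
Qed.

(** Otherwise [C] lies in the ball of radius [r] around [z]. The factor 2 is the source of the
    condition [2 rho < delta]. *)
Lemma diam_far (C : set V) (z : V) (r : R) :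
  C z -> 2 * r < diam C -> exists2 y, C y & r < `|y - z|.
Proof.
move=> Cz rC; apply: contrapT => /forall2NP far.
suff : diam C <= 2 * r by lra.
have near_z y : C y -> `|y - z| <= r.
  by move=> Cy; have [//|/negP] := far y; rewrite -leNgt.
apply: ge_sup; first by exists `|z - z|, z => //; exists z.
move=> _ [x Cx [y Cy <-]].
have := ler_distD z x y; have := near_z _ Cx; have := near_z _ Cy.
by rewrite (distrC y); lra.
Qed.

Lemma norm_sub_le_diam (C : set V) (x y : V) :
  C `<=` [set x | `|x| <= 1] -> C x -> C y -> `|x - y| <= diam C.
Proof.
move=> C1 Cx Cy; apply: sup_upper_bound; last by exists x => //; exists y.
split; first by exists `|x - y|, x => //; exists y.
exists 2 => _ [u Cu [v Cv <-]]; apply: (le_trans (ler_normB _ _)).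
by have := C1 _ Cu; have := C1 _ Cv => /=; lra.
Qed.

Lemma series_combination_ball (lambda : R^nat) (C : nat -> set V) :
  (forall i, 0 <= lambda i) -> series lambda @ \oo --> (1 : R) ->
  (forall i, C i `<=` [set x | `|x| <= 1]) ->
  series_combination lambda C `<=` [set x | `|x| <= 1].
Proof.
move=> l0 l1 C1 x [c Cc cx] /=.
have nd : nondecreasing_seq (series lambda) by exact: nondecreasing_series.
apply: (cvgr_to_le (cvg_norm cx)); apply: nearW => n.
have := nondecreasing_cvgn_le nd (cvgP _ l1) n; rewrite (cvg_lim _ l1)//.
apply: le_trans; apply: (le_trans (ler_norm_sum _ _ _)); apply: ler_sum => i _.
by rewrite normrZ ger0_norm// ler_piMr//; exact: C1.
Qed.

(** The series of differences is eventually constant, so changing finitely many coordinates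
    preserves convergence and shifts the limit by a finite sum. *)
Lemma series_combination_finite_change (lambda : R^nat) (C : nat -> set V)
    (c y : nat -> V) (x : V) (n : nat) :
  series (fun i => lambda i *: c i) @ \oo --> x ->
  (forall i, C i (y i)) -> (forall i, (n <= i)%N -> y i = c i) ->
  series_combination lambda C (x + \sum_(i < n) lambda i *: (y i - c i)).
Proof.
move=> cx Cy yc; exists y => //.
have -> : (fun i => lambda i *: y i) =
    (fun i => lambda i *: c i) + (fun i => lambda i *: (y i - c i)).
  by apply/funext => i /=; rewrite fctE -scalerDr addrC subrK.
rewrite seriesD; apply: cvgD => //; apply: cvg_near_cst.
exists n => // m /= nm; rewrite /series/=.
rewrite -(big_mkord xpredT (fun i => lambda i *: (y i - c i))) (@big_cat_nat _ _ _ n)//=.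
rewrite [X in _ + X]big_nat_cond [X in _ + X]big1 ?addr0//.
move=> i /andP[/andP[ni _] _].
by rewrite yc// subrr scaler0.
Qed.

(** Induction on [n], both sequences starting from [c]: changing coordinate [n] keeps the two sums
    in [W] and increases the norm of their difference by at least [rho * lambda n]. *)
Lemma simultaneous_perturbation (C : nat -> set V) (lambda : R^nat) (rho : R)
    (c : nat -> V) (x : V) (W : set V) :
  (forall i, 0 <= lambda i) ->
  (forall i U f, weakly_open U -> C i `&` U !=set0 ->
    exists y z, [/\ (C i `&` U) y, (C i `&` U) z & `|f| + rho <= `|f + (y - z)|]) ->
  (forall i, C i (c i)) -> weakly_open W -> W x ->
  forall n, exists y z : nat -> V,
    [/\ forall i, C i (y i) /\ C i (z i),
        forall i, (n <= i)%N -> y i = c i /\ z i = c i,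
        W (x + \sum_(i < n) lambda i *: (y i - c i)),
        W (x + \sum_(i < n) lambda i *: (z i - c i)) &
        rho * \sum_(i < n) lambda i <= `|\sum_(i < n) lambda i *: (y i - z i)| ].
Proof.
move=> lambda_ge0 HC Cc oW Wx; elim=> [|n [y [z [Cyz yzc Wy Wz rho_le]]]].
  by exists c, c; split => //; rewrite !big_ord0 ?addr0 ?mulr0 ?normr0.
have [ln0|ln0] := eqVneq (lambda n) 0.
  exists y, z; split => //; first by move=> i /ltnW; exact: yzc.
  - by rewrite big_ord_recr/= ln0 scale0r addr0.
  - by rewrite big_ord_recr/= ln0 scale0r addr0.
  - by rewrite !big_ord_recr/= ln0 scale0r !addr0.
have lngt0 : 0 < lambda n by rewrite lt0r ln0 lambda_ge0.
set sy := \sum_(i < n) _ in Wy; set sz := \sum_(i < n) _ in Wz.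
set s := \sum_(i < n) lambda i *: (y i - z i) in rho_le.
have moveE v (t : V) : v - lambda n *: c n + lambda n *: t = v + lambda n *: (t - c n).
  by rewrite scalerBr addrAC -addrA.
(* A point of [U] can replace [c n] in either sum without leaving [W]; [c n] itself lies in [U] by
   the induction hypothesis. *)
pose U := [set t | W (x + sy - lambda n *: c n + lambda n *: t)] `&`
          [set t | W (x + sz - lambda n *: c n + lambda n *: t)].
have oU : weakly_open U by apply: weakly_openI; exact: weakly_open_affine.
have CU : C n `&` U !=set0.
  exists (c n); split; first exact: Cc.
  by rewrite /U; split; rewrite /= subrK.
(* The factor [(lambda n)^-1] is chosen so that multiplying the resulting inequality by [lambda n]
   gives back [s] plus the new term. *)
have [y' [z' [[Cy' [Wy' _]] [Cz' [_ Wz']] yz']]] := HC n U ((lambda n)^-1 *: s) oU CU.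
pose upd (u : nat -> V) (t : V) i := if i == n then t else u i.
have upd_lt u t (i : 'I_n) : upd u t i = u i by rewrite /upd ltn_eqF.
have updn u t : upd u t n = t by rewrite /upd eqxx.
exists (upd y y'), (upd z z'); split.
- by move=> i; rewrite /upd; case: eqP => [->//|_]; exact: Cyz.
- by move=> i ni; rewrite /upd gtn_eqF//; apply: yzc; exact: ltnW.
- rewrite big_ord_recr/= updn; under eq_bigr do rewrite upd_lt.
  by rewrite addrA -moveE.
- rewrite big_ord_recr/= updn; under eq_bigr do rewrite upd_lt.
  by rewrite addrA -moveE.
- rewrite !big_ord_recr/= !updn; under [in leRHS]eq_bigr do rewrite !upd_lt.
  rewrite -/s; apply: (@le_trans _ _ (lambda n * (`|(lambda n)^-1 *: s| + rho))).
    rewrite normrZ normfV gtr0_norm// !mulrDr mulrA divff// mul1r.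
    by rewrite (mulrC rho (lambda n)) lerD2r.
  rewrite -(ler_pM2l lngt0) in yz'; apply: (le_trans yz').
  by rewrite -[X in X * _](gtr0_norm lngt0) -normrZ scalerDr scalerA divff// scale1r.
Qed.

End normed_space.

(** * Integration in L_1 and pairing with bounded functions *)

Section L1.
Context d (T : measurableType d) (R : realType) (mu : {measure set T -> \bar R}).
Local Notation X := (LspaceType1 mu).
Local Notation integrableR f := (mu.-integrable [set: T] (EFin \o f)).

Lemma L1_integrable (f : X) : integrableR f.
Proof. exact/Lfun1_integrable/(LfunP (Lfun_of f)). Qed.

Lemma integrableR_measurable (f : T -> R) : integrableR f -> measurable_fun setT f.
Proof. by move=> /measurable_int/measurable_EFinP. Qed.

Lemma integrableRD (f g : T -> R) : integrableR f -> integrableR g ->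
  integrableR (fun x => f x + g x).
Proof. by move=> fi gi; exact: (integrableD measurableT fi gi). Qed.

Lemma integrableRB (f g : T -> R) : integrableR f -> integrableR g ->
  integrableR (fun x => f x - g x).
Proof. by move=> fi gi; exact: (integrableB measurableT fi gi). Qed.

Lemma integrableRZ (a : R) (f : T -> R) : integrableR f ->
  integrableR (fun x => a * f x).
Proof. by move=> fi; exact: (integrableZl measurableT a fi). Qed.

Lemma integrableR_le (f g : T -> R) : measurable_fun setT f ->
  (forall x, `|f x| <= `|g x|) -> integrableR g -> integrableR f.
Proof.
move=> mf fg; apply: le_integrable => //; first exact/measurable_EFinP.
by move=> x _ /=; rewrite lee_fin.
Qed.

Lemma Rintegral_ae (f g : T -> R) :
  measurable_fun setT f -> measurable_fun setT g -> f = g %[ae mu] ->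
  \int[mu]_x f x = \int[mu]_x g x.
Proof.
move=> mf mg fg; congr fine; apply: ae_eq_integral => //; try exact/measurable_EFinP.
by apply: filterS fg => x /(_ I) E _; rewrite E.
Qed.

Lemma L1_normE (f : X) : `|f| = \int[mu]_x `|f x|.
Proof. exact: (congr1 fine (Lspace1_normE f)). Qed.

(** Evaluation of a class uses a chosen representative, so the vector operations are pointwise only
    almost everywhere. *)
Lemma L1_addE (f g : X) : ((f + g : X) : T -> R) = (fun x => f x + g x) %[ae mu].
Proof. exact: (Lspace_ofK (Lfun_of f + Lfun_of g)). Qed.

Lemma L1_scaleE (a : R) (f : X) : ((a *: f : X) : T -> R) = (fun x => a * f x) %[ae mu].
Proof. exact: (Lspace_ofK (a *: Lfun_of f)). Qed.

Lemma L1_oppE (f : X) : ((- f : X) : T -> R) = (fun x => - f x) %[ae mu].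
Proof. exact: (Lspace_ofK (- Lfun_of f)). Qed.

Lemma L1_subE (f g : X) : ((f - g : X) : T -> R) = (fun x => f x - g x) %[ae mu].
Proof.
apply: filterS2 (L1_addE f (- g)) (L1_oppE g) => x /(_ I) + /(_ I) E.
by rewrite E.
Qed.

(** The easy half of the duality between L_1 and bounded functions, valid over every measure:
    [|F y| <= |y|] because [|h| <= 1]. *)
Lemma L1_functional (h : T -> R) : measurable_fun setT h -> (forall x, `|h x| <= 1) ->
  exists2 F : {linear X -> R^o}, continuous F &
    forall y : X, F y = \int[mu]_x (h x * y x).
Proof.
move=> mh h1; pose F (y : X) : R^o := \int[mu]_x (h x * y x).
have hI (g : T -> R) : integrableR g -> integrableR (fun x => h x * g x).
  move=> gi; apply: (integrableR_le _ _ gi).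
    exact: measurable_funM mh (integrableR_measurable gi).
  by move=> x; rewrite normrM ler_piMl.
have linF : linear F.
  move=> a f g; rewrite /F.
  have fi := L1_integrable f; have gi := L1_integrable g.
  transitivity (\int[mu]_x (a * (h x * f x) + h x * g x)).
    apply: Rintegral_ae.
    - exact: integrableR_measurable (hI _ (L1_integrable _)).
    - apply: integrableR_measurable; apply: integrableRD; last exact: hI.
      exact/integrableRZ/hI.
    apply: filterS2 (L1_addE (a *: f) g) (L1_scaleE a f) => x /(_ I) E1 /(_ I) E2 _.
    by rewrite E1 E2; ring.
  rewrite RintegralD//; last 2 first.
    exact/integrableRZ/hI.
    exact: hI.
  by rewrite RintegralZl//; exact: hI.
pose FL := GRing.isLinear.Build R X R^o *:%R F linF.
pose G : {linear X -> R^o} := HB.pack_for {linear X -> R^o} F FL.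
exists G; last by [].

apply: (@bounded_linear_continuous R X R^o G); apply/linear_boundedP.
near=> r => y; rewrite /= /F L1_normE.
apply: (@le_trans _ _ (\int[mu]_x `|h x * y x|)).
  by apply: le_normr_Rintegral => //; exact/hI/L1_integrable.
apply: (@le_trans _ _ (\int[mu]_x `|y x|)).
  apply: le_Rintegral => //.
  - exact/integrable_norm/hI/L1_integrable.
  - exact/integrable_norm/L1_integrable.
  - by move=> x _; rewrite normrM ler_piMl.
by rewrite ler_peMl ?Rintegral_ge0.
Unshelve. all: by end_near.
Qed.

(** * Completeness of L_1 *)

Lemma L1_of_integrable (f : T -> R) : integrableR f ->
  exists g : X, (g : T -> R) = f %[ae mu].
Proof.
move=> /Lfun1_integrable fL; exists (Lspace_of (Lfun_Sub (lexx 1%E) fL)).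
exact: Lspace_ofK.
Qed.

Lemma L1_sumE (u : nat -> X) n :
  ((series u n : X) : T -> R) = (fun x => series (fun i => u i x) n) %[ae mu].
Proof.
elim: n => [|n IH].
  rewrite /series/= big_geq//; apply: filterS (L1_scaleE 0 (0 : X)) => x /(_ I) E _.
  by rewrite big_geq// -[RHS](mul0r ((0 : X) x)) -E scale0r.
rewrite seriesSr; apply: filterS2 IH (L1_addE (series u n) (u n)).
by move=> x /(_ I) E1 /(_ I) E2 _; rewrite E2 E1 [RHS]seriesSr.
Qed.

(** Riesz-Fischer argument: the sum [g] of the absolute values is integrable, hence finite almost
    everywhere, and dominates the partial sums, so dominated convergence gives the limit in norm. *)
Lemma L1_normed_cvg (u : nat -> X) : cvgn [normed series u] ->
  exists l : X, series u @ \oo --> l.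
Proof.
move=> ucvg; pose g x := (\sum_(n <oo) `|u n x|%:E)%E.
have mu_ n : measurable_fun setT (u n : T -> R).
  exact: integrableR_measurable (L1_integrable _).
have mg : measurable_fun setT g.
  apply: ge0_emeasurable_sum => // n _; apply/measurable_EFinP.
  exact: measurableT_comp.
have g0 x : (0 <= g x)%E by exact: nneseries_ge0.
have gi : mu.-integrable setT g.
  apply/integrableP; split => //.
  under eq_integral do rewrite gee0_abs//.
  rewrite integral_nneseries//; last first.
    by move=> n; apply/measurable_EFinP; exact: measurableT_comp.
  under eq_eseriesr do rewrite -Lspace1_normE.
  rewrite (_ : (fun n => _) = EFin \o [normed series u]); last first.
    by apply/funext => n /=; rewrite sumEFin.
  by rewrite EFin_lim// ltry.
pose f_ n x := (series (fun i => u i x) n)%:E.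
have mf_ n : measurable_fun setT (f_ n).
  by apply/measurable_EFinP; exact: measurable_sum.
(* The upper limit is measurable on the whole space and equals the sum wherever the series
   converges. *)
pose f x := fine (limn_esup (f_ ^~ x)).
have mf : measurable_fun setT f.
  apply: measurableT_comp => //; exact: measurable_fun_limn_esup.
have f_f : {ae mu, forall x, setT x -> f_ ^~ x @ \oo --> (f x)%:E}.
  apply: filterS (integrable_ae measurableT gi) => x /(_ I) gx _.
  have cu : cvgn (series (fun i => u i x)).
    apply: normed_cvg; apply: nnseries_is_cvg => [i|]; first exact: normr_ge0.
    by move: gx; rewrite ge0_fin_numE.
  have cf : f_ ^~ x @ \oo --> (limn (series (fun i => u i x)))%:E.
    by apply: cvg_EFin; [exact: nearW|exact: cu].
  by rewrite /f is_cvg_limn_esupE ?(cvg_lim _ cf)//; apply: cvgP cf.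
have f_g : {ae mu, forall x n, setT x -> (`|f_ n x| <= g x)%E}.
  apply: aeW => x n _; rewrite /f_ /series/=.
  apply: (@le_trans _ _ (\sum_(0 <= i < n) `|u i x|)%:E).
    by rewrite lee_fin ler_norm_sum.
  by rewrite -sumEFin; apply: nneseries_lim_ge.
have [fi lim0 _] := dominated_convergence measurableT mf_
  ((measurable_EFinP _ _).2 mf) f_f gi f_g.
have [l lE] := L1_of_integrable fi; exists l.
have normE n : (\int[mu]_x `|f_ n x - (f x)%:E|)%E = `|series u n - l|%:E.
  rewrite Lspace1_normE; apply: ae_eq_integral => //.
  - apply: measurableT_comp => //; apply: emeasurable_funB => //.
    exact/measurable_EFinP.
  - by apply/measurable_EFinP; exact: measurableT_comp.
  apply: filterS3 (L1_subE (series u n) l) (L1_sumE u n) lE.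
  by move=> x /(_ I) E1 /(_ I) E2 /(_ I) E3 _; rewrite E1 E2 E3.
apply/subr_cvg0/norm_cvg0P.
apply: (fine_cvg (f := fun n => `|series u n - l|%:E)).
by under eq_fun do rewrite -normE.
Qed.

(** * The convex functional [Phi] and its linearization *)

Lemma measurable_hypot (f g : T -> R) : measurable_fun setT f ->
  measurable_fun setT g ->
  measurable_fun setT (fun x => Num.sqrt (f x ^+ 2 + g x ^+ 2)).
Proof.
move=> mf mg; apply: (@measurableT_comp _ _ _ _ _ _ (@Num.sqrt R)).
  by apply: continuous_measurable_fun; exact: sqrt_continuous.
by apply: measurable_funD; exact: measurable_funX.
Qed.

Lemma integrable_hypot (f g : X) :
  integrableR (fun x => Num.sqrt (f x ^+ 2 + g x ^+ 2)).
Proof.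
have fi := L1_integrable f; have gi := L1_integrable g.
apply: (integrableR_le _ _ (integrableRD (integrable_norm fi) (integrable_norm gi))).
  exact: measurable_hypot (integrableR_measurable fi) (integrableR_measurable gi).
move=> x /=; rewrite ger0_norm ?sqrtr_ge0// [leRHS]ger0_norm ?addr_ge0//.
exact: hypot_le.
Qed.

Lemma Rintegral_hypot_le (f g : X) :
  \int[mu]_x Num.sqrt (f x ^+ 2 + g x ^+ 2) <= `|f| + `|g|.
Proof.
have fi := integrable_norm (L1_integrable f).
have gi := integrable_norm (L1_integrable g).
rewrite !L1_normE -RintegralD//; apply: le_Rintegral => //.
- exact: integrable_hypot.
- exact: integrableRD.
- by move=> x _; exact: hypot_le.
Qed.

(** [F] is the derivative of [Phi] at [z]. Its density [h] is bounded by 1, so [F] is continuous and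
    may define weak neighbourhoods. *)
Lemma hypot_gap_functional (f z : X) :
  exists2 F : {linear X -> R^o}, continuous F & forall y : X,
    integrableR (fun x => hypot_gap (f x) (y x) (z x)) /\
    \int[mu]_x hypot_gap (f x) (y x) (z x) =
      \int[mu]_x Num.sqrt (f x ^+ 2 + y x ^+ 2)
      - \int[mu]_x Num.sqrt (f x ^+ 2 + z x ^+ 2) - (F y - F z).
Proof.
have mf := integrableR_measurable (L1_integrable f).
have mz := integrableR_measurable (L1_integrable z).
pose h x := z x / Num.sqrt (f x ^+ 2 + z x ^+ 2).
have mh : measurable_fun setT h.
  apply: measurable_funM => //.
  (* Inversion agrees with the power [-1] on nonnegative reals, including 0, and the power function
     is measurable. *)
  rewrite (_ : (fun x => _) = (fun x => Num.sqrt (f x ^+ 2 + z x ^+ 2) `^ (-1))).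
    apply: (@measurableT_comp _ _ _ _ _ _ (@powR R ^~ (-1))).
      exact: measurable_powR.
    exact: measurable_hypot.
  by apply/funext => x; rewrite powR_inv1// sqrtr_ge0.
have h1 x : `|h x| <= 1 by exact: norm_div_hypot_le1.
have [F cF FE] := L1_functional mh h1; exists F => // y.
have hI (g : X) : integrableR (fun x => h x * g x).
  have gi := L1_integrable g; apply: (integrableR_le _ _ gi).
    exact: measurable_funM mh (integrableR_measurable gi).
  by move=> x; rewrite normrM ler_piMl.
have yfi := integrable_hypot f y; have zfi := integrable_hypot f z.
have gapE : (fun x => hypot_gap (f x) (y x) (z x)) =
    (fun x => (Num.sqrt (f x ^+ 2 + y x ^+ 2) - Num.sqrt (f x ^+ 2 + z x ^+ 2))
      - (h x * y x - h x * z x)).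
  by apply/funext => x; rewrite /hypot_gap -/(h x) mulrBr.
rewrite gapE; split; first by do !apply: integrableRB.
by rewrite !RintegralB// ?FE//; exact: integrableRB.
Qed.

(** The integral of [norm_addB_ge]: with [M] large and [eta] small, the norms almost add up as soon
    as the integrated gap is small. *)
Lemma L1_norm_addB_ge (f y z : X) (M eta : R) : 1 <= M -> 0 < eta -> eta <= 1 ->
  `|f| + `|y - z| <= `|f + (y - z)| + 2 * (M^-1 * `|z| + eta * `|f|
    + 12 * M ^+ 3 / eta * \int[mu]_x hypot_gap (f x) (y x) (z x)).
Proof.
move=> M1 eta0 eta1; have [F _ /(_ y)[gi _]] := hypot_gap_functional f z.
have ni (g : X) := integrable_norm (L1_integrable g).
have yzi := integrable_norm (integrableRB (L1_integrable y) (L1_integrable z)).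
have fyzi := integrable_norm (integrableRD (L1_integrable f)
  (integrableRB (L1_integrable y) (L1_integrable z))).
rewrite !L1_normE.
have -> : \int[mu]_x `|(y - z : X) x| = \int[mu]_x `|y x - z x|.
  apply: Rintegral_ae.
  - exact: integrableR_measurable (ni (y - z)).
  - exact: integrableR_measurable yzi.
  by apply: filterS (L1_subE y z) => x /(_ I) E _; rewrite E.
have -> : \int[mu]_x `|(f + (y - z) : X) x| = \int[mu]_x `|f x + (y x - z x)|.
  apply: Rintegral_ae.
  - exact: integrableR_measurable (ni (f + (y - z))).
  - exact: integrableR_measurable fyzi.
  apply: filterS2 (L1_addE f (y - z)) (L1_subE y z) => x /(_ I) E1 /(_ I) E2 _.
  by rewrite E1 E2.
pose b x := `|f x + (y x - z x)| + 2 * (M^-1 * `|z x| + eta * `|f x|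
  + 12 * M ^+ 3 / eta * hypot_gap (f x) (y x) (z x)).
have intb : integrableR b.
  apply: integrableRD => //; apply: integrableRZ.
  apply: integrableRD; last exact: integrableRZ.
  by apply: integrableRD; apply: integrableRZ; exact: ni.
apply: (@le_trans _ _ (\int[mu]_x b x)).
  rewrite -RintegralD//; last exact: ni.
  apply: le_Rintegral => //; first exact: integrableRD (ni f) yzi.
  by move=> x _; exact: norm_addB_ge.
have Iz := integrableRZ M^-1 (ni z); have If := integrableRZ eta (ni f).
have Ig := integrableRZ (12 * M ^+ 3 / eta) gi.
have Izf := integrableRD Iz If; have Izfg := integrableRD Izf Ig.
rewrite /b RintegralD//; last exact: integrableRZ.
rewrite RintegralZl// RintegralD// RintegralD// !RintegralZl//; exact: ni.
Qed.


(** * The perturbation property of wHD sets in L_1 *)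

Lemma wHD_L1_perturbation (C W : set X) (delta rho : R) (f : X) :
  wHD delta C -> 2 * rho < delta -> weakly_open W -> C `&` W !=set0 ->
  exists y z, [/\ (C `&` W) y, (C `&` W) z & `|f| + rho <= `|f + (y - z)|].
Proof.
move=> [_ C1 Cdiam] rho_lt oW CW.
(* Each of the three error terms will be at most [k], a total loss of [6 k] after doubling. Hence
   [|y - z| > rho + 6 k] is required, and [2 (rho + 6 k) < 2 rho + 16 k = delta]. *)
pose k := (delta - 2 * rho) / 16; have k0 : 0 < k by rewrite /k; lra.
pose M := 1 + k^-1; pose eta := k / (k + `|f|).
have ki : 0 < k^-1 by rewrite invr_gt0.
have f0 : 0 <= `|f| by [].
have M1 : 1 <= M by rewrite /M; lra.
have eta0 : 0 < eta by rewrite divr_gt0//; lra.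
have eta1 : eta <= 1 by rewrite ler_pdivrMr; lra.
have etaf : eta * `|f| <= k.
  by rewrite /eta mulrAC ler_pdivrMr; [rewrite ler_pM2l//; lra|lra].
have Mk : M^-1 <= k by rewrite -[leRHS]invrK lef_pV2 ?posrE /M; lra.
pose K := 12 * M ^+ 3 / eta.
have K0 : 0 < K by rewrite /K divr_gt0// mulr_gt0// exprn_gt0//; lra.
(* Near-maximality of [z] and the strip around [F z] each contribute [e] to the integrated gap, and
   [K * (2 e) = k]. *)
pose e := k / (2 * K); have e0 : 0 < e by rewrite divr_gt0// mulr_gt0.
pose Phi (g : X) := \int[mu]_x Num.sqrt (f x ^+ 2 + g x ^+ 2).
have supP : has_sup [set Phi g | g in C `&` W].
  split; first by case: CW => g CWg; exists (Phi g), g.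
  exists (`|f| + 1) => _ [g [Cg _] <-].
  by apply: (le_trans (Rintegral_hypot_le f g)); rewrite lerD2l; exact: C1.
(* The supremum is taken over the whole of [C] within [W], so it also bounds [Phi y] for the [y]
   found later in the smaller set [W']. *)
have [_ [z [Cz Wz] <-] zsup] := sup_adherent e0 supP.
have [F cF FE] := hypot_gap_functional f z.
pose W' := W `&` [set y | `|F y - F z| < e].
have oW' : weakly_open W'.
  by apply: weakly_openI => //; exact: weakly_open_strip.
have W'z : (C `&` W') z by split => //; split => //=; rewrite subrr normr0.
have diamW' : 2 * (rho + 6 * k) < diam (C `&` W').
  by apply: (@lt_le_trans _ _ delta); [rewrite /k; lra|apply: Cdiam => //; exists z].
have [y [Cy [Wy Fy]] yz] := diam_far W'z diamW'.
exists y, z; split => //.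
have := L1_norm_addB_ge f y z M1 eta0 eta1; rewrite -/K.
have [_ ->] := FE y; rewrite -/(Phi y) -/(Phi z) => key.
have ysup : Phi y <= sup [set Phi g | g in C `&` W].
  by apply: sup_upper_bound => //; exists y.
have gap : Phi y - Phi z - (F y - F z) <= 2 * e.
  by move: Fy => /=; rewrite ltr_norml => /andP[]; lra.
have Kgap : K * (Phi y - Phi z - (F y - F z)) <= k.
  apply: (@le_trans _ _ (K * (2 * e))); first by rewrite ler_pM2l.
  by rewrite /e le_eqVlt; apply/orP; left; apply/eqP; field; lra.
have Mz : M^-1 * `|z| <= k.
  apply: (le_trans _ Mk); rewrite ler_piMr ?invr_ge0//; [lra|exact: C1].
lra.
Qed.

End L1.

(** * Non-emptiness and large weak slices of the series combination *)

Theorem theorem1p1 (R : realType) (d : measure_display) (T : measurableType d)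
    (mu : {measure set T -> \bar R}) (delta : R)
    (C : nat -> set (LspaceType1 mu)) (lambda : R^nat)
    (delta_gt0 : 0 < delta) (delta_le2 : delta <= 2)
    (wHD_C : forall i, wHD delta (C i))
    (lambda_ge0 : forall i, 0 <= lambda i)
    (lambda_sum1 : series lambda @ \oo --> (1 : R)) :
  wHD (delta / 4) (series_combination lambda C).
Proof.
have C1 i : C i `<=` [set x | `|x| <= 1] by have [] := wHD_C i.
have S1 := series_combination_ball lambda_ge0 lambda_sum1 C1.
split => //.
  have /choice[c Cc] : forall i, exists x, C i x by move=> i; have [] := wHD_C i.
  (* Any choice of points gives an absolutely convergent series, dominated by [lambda]; completeness
     supplies its sum. *)
  have [|l cl] := @L1_normed_cvg _ _ _ mu (fun i => lambda i *: c i).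
    apply: (@series_le_cvg _ _ lambda) => [i|//|i|]; first exact: normr_ge0.
      by rewrite /= normrZ ger0_norm// ler_piMr//; exact: C1.
    exact: cvgP lambda_sum1.
  by exists l, c.
move=> W oW [x [[c Cc cx] Wx]].
(* The constants satisfy [2 / 3 * (3 / 8) = 1 / 4], where [2 / 3 < 1] is reached by partial sums and
   [rho = 3 / 8 * delta] meets [2 rho < delta]. *)
have [n sum_ge] : exists n, 2 / 3 <= \sum_(i < n) lambda i.
  have : \forall n \near \oo, 2 / 3 <= series lambda n.
    by apply: (cvgr_ge _ lambda_sum1); lra.
  by move=> [n _ /(_ n (leqnn n))]; rewrite /series/= big_mkord => H; exists n.
have HC i U f : weakly_open U -> C i `&` U !=set0 ->
    exists y z, [/\ (C i `&` U) y, (C i `&` U) z &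
                    `|f| + 3 / 8 * delta <= `|f + (y - z)|].
  by apply: (wHD_L1_perturbation _ (wHD_C i)); lra.
have [y [z [Cyz yzc Wy Wz far]]] :=
  simultaneous_perturbation lambda_ge0 HC Cc oW Wx n.
have Sy := series_combination_finite_change cx (fun i => (Cyz i).1)
  (fun i h => (yzc i h).1).
have Sz := series_combination_finite_change cx (fun i => (Cyz i).2)
  (fun i h => (yzc i h).2).
apply: le_trans (norm_sub_le_diam _ (conj Sy Wy) (conj Sz Wz)).
  (* Both [x] and the base points [c i] cancel in the difference of the two sums. *)
  rewrite opprD addrACA subrr add0r -sumrB.
  under eq_bigr do rewrite -scalerBr opprB addrA subrK.
  by apply: le_trans far; nra.
by move=> v [/S1].
Qed.
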